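(* Let $0<\epsilon<1$. Let $\mathbf{B}$ be an $n^{\epsilon}$-approximation insertion-deletion streaming algorithm for \textsf{Minimum Vertex Cover} on $n$-vertex bipartite graphs that uses space $s$ and errs with probability at most $1/400$. Then, for all sufficiently large $n$, there exists a (public-coin randomised one-way) communication protocol for $\textsf{BInd}^{n,\,n-\frac{1}{40}n^{1-\epsilon}}_{1/3}$ that communicates $\mathrm{O}(s)$ bits.
   Context: An insertion-deletion graph stream on a fixed vertex set is a sequence of edge insertions and edge deletions, where each deletion removes a currently present edge; the input graph consists of the edges present at the end. A $C$-approximation insertion-deletion streaming algorithm for \textsf{Minimum Vertex Cover} erring with probability at most $p$ uses $s$ bits of memory and, with probability at least $1-p$, outputs a vertex cover of the final graph of size at most $C$ times the minimum vertex cover size. The problem $\textsf{BInd}^{n,k}_\delta$: Alice holds $A\in\{0,1\}^{n\times n}$; Bob holds $x,y\in[n-k]$ (where $[m]=\{1,\dots,m\}$) and the entries $(A_{i,j})_{(i,j)\in S(x,y)}$ with $S(x,y)=\{(i,j)\in[n]^2 : x\le i<x+k,\ y\le j<y+k\}\setminus\{(x,y)\}$; Alice sends one message to Bob, who must output $A_{x,y}$ with probability at least $1-\delta$. *)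

(* Defs.v *)
From mathcomp Require Import all_boot all_order all_algebra.
From mathcomp Require Import reals exp.
Set Implicit Arguments.
Unset Strict Implicit.
Unset Printing Implicit Defensive.
Import Order.TTheory GRing.Theory Num.Theory.
Local Open Scope ring_scope.

Record fdist (R : realType) (T : finType) := FDist {
  pmf :> T -> R;
  pmf_ge0 : forall a, 0 <= pmf a;
  pmf_sum1 : \sum_a pmf a = 1 }.

Definition Prob (R : realType) (T : finType) (d : fdist R T) (P : pred T) : R :=
  \sum_(a | P a) d a.

Section Bind.
Variables (R : realType) (T U : finType) (d : fdist R T) (f : T -> fdist R U).

Definition bind_pmf (b : U) : R := \sum_a d a * f a b.

Lemma bind_pmf_ge0 b : 0 <= bind_pmf b.
Proof. by apply: sumr_ge0 => a _; rewrite mulr_ge0 ?pmf_ge0. Qed.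

Lemma bind_pmf_sum1 : \sum_b bind_pmf b = 1.
Proof.
rewrite exchange_big -[RHS](pmf_sum1 d); apply: eq_bigr => a _.
by rewrite -mulr_sumr pmf_sum1 mulr1.
Qed.

Definition fdist_bind : fdist R U := FDist bind_pmf_ge0 bind_pmf_sum1.
End Bind.

(* Edges are two-element vertex sets, and a graph on V is its edge set; the
   streams are restricted to genuine edges by [valid_from]. *)
Variant update (V : finType) := Insert of {set V} | Delete of {set V}.

Definition apply_update (V : finType) (E : {set {set V}}) (u : update V) :
    {set {set V}} :=
  match u with Insert e => e |: E | Delete e => E :\ e end.

Definition valid_update (V : finType) (E : {set {set V}}) (u : update V) : bool :=
  match u with
  | Insert e => (#|e| == 2) && (e \notin E)
  | Delete e => e \in E
  end.

Fixpoint valid_from (V : finType) (E : {set {set V}}) (st : seq (update V)) : bool :=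
  if st is u :: st' then valid_update E u && valid_from (apply_update E u) st'
  else true.

Definition valid_stream (V : finType) (st : seq (update V)) : bool :=
  valid_from set0 st.

Definition final_graph (V : finType) (st : seq (update V)) : {set {set V}} :=
  foldl (@apply_update V) set0 st.

Definition bipartite (V : finType) (E : {set {set V}}) : Prop :=
  exists L : {set V}, forall e, e \in E -> #|e :&: L| = 1%N /\ #|e :\: L| = 1%N.

Definition vertex_cover (V : finType) (E : {set {set V}}) (U : {set V}) : bool :=
  [forall e in E, e :&: U != set0].

Definition vc_number (V : finType) (E : {set {set V}}) : nat :=
  #|[arg min_(U < [set: V] | vertex_cover E U) #|U|]|.

(* The memory is s bits. The algorithm may toss fresh coins at every step (so
   it is a Markov kernel on memory states) and may moreover consult a random
   string, drawn once independently of the input and not charged to the memory. *)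
Record stream_alg (R : realType) (V : finType) (s : nat) := StreamAlg {
  alg_rand : finType;
  alg_dist : fdist R alg_rand;
  alg_init : alg_rand -> fdist R (s.-tuple bool);
  alg_step : alg_rand -> s.-tuple bool -> update V -> fdist R (s.-tuple bool);
  alg_out : alg_rand -> s.-tuple bool -> fdist R {set V} }.

Definition alg_memory (R : realType) (V : finType) (s : nat)
    (B : stream_alg R V s) (r : alg_rand B) (st : seq (update V)) :
    fdist R (s.-tuple bool) :=
  foldl (fun mu u => fdist_bind mu (fun q => alg_step r q u)) (alg_init r) st.

Definition alg_result (R : realType) (V : finType) (s : nat)
    (B : stream_alg R V s) (st : seq (update V)) : fdist R {set V} :=
  fdist_bind (alg_dist B) (fun r => fdist_bind (alg_memory r st) (alg_out r)).

Definition mvc_approx_bipartite (R : realType) (V : finType) (s : nat)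
    (B : stream_alg R V s) (c p : R) : Prop :=
  forall st : seq (update V), valid_stream st -> bipartite (final_graph st) ->
    1 - p <= Prob (alg_result B st)
               (fun U => vertex_cover (final_graph st) U &&
                         (#|U|%:R <= c * (vc_number (final_graph st))%:R)).

(* Both parties see the outcome of the same public coins; private coins are
   subsumed. *)
Record oneway_protocol (R : realType) (X Y Z : Type) (t : nat) := OneWay {
  pub_rand : finType;
  pub_dist : fdist R pub_rand;
  alice : pub_rand -> X -> t.-tuple bool;
  bob : pub_rand -> t.-tuple bool -> Y -> Z }.

(* Indices start at 0, so that [n] is 'I_n and [n-k] is 'I_(n - k); S(x,y) is
   invariant under this shift. *)
Definition bind_index (n k : nat) (x : 'I_(n - k)) : 'I_n :=
  widen_ord (leq_subr k n) x.

Definition bind_known (n k : nat) (x y : 'I_(n - k)) (i j : 'I_n) : bool :=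
  [&& (x <= i < x + k)%N, (y <= j < y + k)%N &
      (i, j) != (bind_index x, bind_index y)].

Definition bind_view (n k : nat) (A : 'M[bool]_n) (x y : 'I_(n - k)) :
    'M[option bool]_n :=
  \matrix_(i, j) (if bind_known x y i j then Some (A i j) else None).

Definition bob_input (n k : nat) : Type :=
  ('I_(n - k) * 'I_(n - k) * 'M[option bool]_n)%type.

Definition solves_BInd (R : realType) (n k t : nat)
    (Pi : oneway_protocol R 'M[bool]_n (bob_input n k) bool t) (delta : R) : Prop :=
  forall (A : 'M[bool]_n) (x y : 'I_(n - k)),
    1 - delta <= Prob (pub_dist Pi)
      (fun r => bob r (alice r A) (x, y, bind_view A x y)
                == A (bind_index x) (bind_index y)).

(* Main.v *)
Require Import Defs.
From mathcomp Require Import all_boot all_order all_algebra all_fingroup.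
From mathcomp Require Import reals exp lra zify.
Set Implicit Arguments.
Unset Strict Implicit.
Unset Printing Implicit Defensive.
Import Order.TTheory GRing.Theory Num.Theory.
Local Open Scope ring_scope.

(* Public coins choose a uniform permutation pi of the n vertices, half of which
   serve as rows and half as columns, and a uniform set W of vertex pairs. Alice
   runs the algorithm on the bipartite graph M whose adjacency is her matrix xored
   with W, and sends the memory state. Bob deletes every edge of M between rows
   >= x and columns >= y except possibly (x, y), whose status he does not know;
   he answers "is row x or column y in the output cover?", xored with W at (x, y).
   If (x, y) is an edge of M, every cover contains x or y. Otherwise x + y
   vertices cover what is left, so the output has size at most
   n^eps (x + y) <= n/20. As M is independent of pi, composing pi with a
   transposition shows that row x is distributed, given the stream, uniformly
   among the rows >= x, of which there are at least 2n/5; so it is hit with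
   probability at most 1/8, and likewise column y.
   Since Bob only ever asks about the first n - k rows and columns, n/2 rows and
   n/2 columns suffice and no graph on 2n vertices is needed. *)

(** * Expectations, product distributions and public coins *)

Section Expectation.
Variable R : realType.
Implicit Types T U : finType.

Definition expect T (d : fdist R T) (g : T -> R) : R := \sum_a d a * g a.

Lemma ProbE T (d : fdist R T) (P : pred T) :
  Prob d P = expect d (fun a => (P a)%:R).
Proof.
rewrite /Prob /expect big_mkcond; apply: eq_bigr => a _.
by case: (P a); rewrite ?mulr1 ?mulr0.
Qed.

Lemma eq_expect T (d : fdist R T) (g h : T -> R) :
  g =1 h -> expect d g = expect d h.
Proof. by move=> gh; apply: eq_bigr => a _; rewrite gh. Qed.

Lemma le_expect T (d : fdist R T) (g h : T -> R) :
  (forall a, g a <= h a) -> expect d g <= expect d h.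
Proof. by move=> gh; apply: ler_sum => a _; rewrite ler_wpM2l ?pmf_ge0. Qed.

Lemma expect_cst T (d : fdist R T) (c : R) : expect d (fun=> c) = c.
Proof. by rewrite /expect -mulr_suml pmf_sum1 mul1r. Qed.

Lemma expectD T (d : fdist R T) (g h : T -> R) :
  expect d (fun a => g a + h a) = expect d g + expect d h.
Proof. by rewrite /expect -big_split; apply: eq_bigr => a _; rewrite mulrDr. Qed.

Lemma expect_sum T (I : finType) (J : pred I) (d : fdist R T) (g : I -> T -> R) :
  expect d (fun a => \sum_(i | J i) g i a) = \sum_(i | J i) expect d (g i).
Proof.
by rewrite /expect exchange_big; apply: eq_bigr => a _; rewrite mulr_sumr.
Qed.

Lemma expect_bind T U (d : fdist R T) (f : T -> fdist R U) (g : U -> R) :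
  expect (fdist_bind d f) g = expect d (fun a => expect (f a) g).
Proof.
rewrite /expect /= /bind_pmf; under eq_bigr do rewrite mulr_suml.
rewrite exchange_big; apply: eq_bigr => a _; rewrite mulr_sumr.
by apply: eq_bigr => b _; rewrite mulrA.
Qed.

Lemma dirac_ge0 T (t a : T) : 0 <= (a == t)%:R :> R.
Proof. exact: ler0n. Qed.

Lemma dirac_sum1 T (t : T) : \sum_a (a == t)%:R = 1 :> R.
Proof. by rewrite (bigD1 t) //= eqxx big1 ?addr0 // => a /negPf->. Qed.

Definition fdist_dirac T (t : T) : fdist R T := FDist (dirac_ge0 t) (dirac_sum1 t).

Lemma expect_dirac T (t : T) (g : T -> R) : expect (fdist_dirac t) g = g t.
Proof.
rewrite /expect (bigD1 t) //= eqxx mul1r big1 ?addr0 // => a /negPf->.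
by rewrite mul0r.
Qed.

Lemma uniform_ge0 T (t a : T) : 0 <= #|T|%:R^-1 :> R.
Proof. by rewrite invr_ge0 ler0n. Qed.

Lemma uniform_sum1 T (t : T) : \sum_(a : T) #|T|%:R^-1 = 1 :> R.
Proof.
rewrite sumr_const -[LHS]mulr_natr mulVf // pnatr_eq0 -lt0n.
by apply/card_gt0P; exists t.
Qed.

Definition fdist_uniform T (t : T) : fdist R T :=
  FDist (uniform_ge0 t) (uniform_sum1 t).

Lemma expect_reindex T (t : T) (f : T -> T) (g : T -> R) :
  injective f -> expect (fdist_uniform t) (g \o f) = expect (fdist_uniform t) g.
Proof. by move=> f_inj; rewrite /expect /= [RHS](reindex_inj f_inj). Qed.

Lemma le_Prob T (d : fdist R T) (P Q : pred T) :
  (forall a, P a -> Q a) -> Prob d P <= Prob d Q.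
Proof.
move=> PQ; rewrite !ProbE; apply: le_expect => a; rewrite ler_nat.
by have := PQ a; case: (P a); case: (Q a) => // /(_ isT).
Qed.

Lemma Prob_predU T (d : fdist R T) (P Q : pred T) :
  Prob d (predU P Q) <= Prob d P + Prob d Q.
Proof.
rewrite !ProbE -expectD; apply: le_expect => a; rewrite -natrD ler_nat /=.
by case: (P a); case: (Q a).
Qed.

Lemma Prob_predC T (d : fdist R T) (P : pred T) :
  Prob d (predC P) = 1 - Prob d P.
Proof.
rewrite -(expect_cst d 1) !ProbE; apply/eqP; rewrite eq_sym subr_eq -expectD.
by apply/eqP; apply: eq_expect => a /=; case: (P a); rewrite /= ?addr0 ?add0r.
Qed.

Section Product.
Variables (T U : finType) (d : T -> fdist R U).

Lemma prod_ge0 (f : {ffun T -> U}) : 0 <= \prod_t d t (f t).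
Proof. by apply: prodr_ge0 => t _; exact: pmf_ge0. Qed.

Lemma prod_sum1 : \sum_(f : {ffun T -> U}) \prod_t d t (f t) = 1.
Proof.
rewrite -(bigA_distr_bigA (fun t u => d t u)) big1 // => t _.
exact: pmf_sum1.
Qed.

Definition fdist_prod : fdist R {ffun T -> U} := FDist prod_ge0 prod_sum1.

(** Attaching [g] to the factor at [t] turns the sum over functions into a product of sums, in which
    every other coordinate contributes 1. *)
Lemma expect_prod (t : T) (g : U -> R) :
  expect fdist_prod (fun f => g (f t)) = expect (d t) g.
Proof.
pose F i u := d i u * (if i == t then g u else 1).
transitivity (\prod_i \sum_u F i u).
  rewrite bigA_distr_bigA /expect; apply: eq_bigr => f _ /=.
  rewrite big_split /=; congr (_ * _).
  by rewrite (bigD1 t) //= eqxx big1 ?mulr1 // => i /negPf->.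
rewrite (bigD1 t) //= [X in _ * X]big1 ?mulr1 => [|i /negPf it].
  by apply: eq_bigr => u _; rewrite /F eqxx.
by rewrite -[RHS](pmf_sum1 (d i)); apply: eq_bigr => u _; rewrite /F it mulr1.
Qed.

End Product.

(* Private coins become public ones by drawing in advance, independently for
   every possible input, the outcome that each party would have sampled. *)
Lemma public_coins (O X Y M Z : finType) (d : fdist R O)
    (a : O -> X -> fdist R M) (b : O -> M -> Y -> fdist R Z) :
  exists (O' : finType) (d' : fdist R O') (w : O' -> O)
         (a' : O' -> X -> M) (b' : O' -> M -> Y -> Z),
    forall x y (P : O -> pred Z),
      Prob d' (fun r => P (w r) (b' r (a' r x) y)) =
      expect d (fun o => expect (a o x) (fun m => Prob (b o m y) (P o))).
Proof.
pose d' := fdist_bind d (fun o => fdist_bind (fdist_prod (a o)) (fun f =>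
  fdist_bind (fdist_prod (fun my => b o my.1 my.2)) (fun h =>
  fdist_dirac (o, f, h)))).
exists (O * {ffun X -> M} * {ffun M * Y -> Z})%type, d', (fun r => r.1.1),
  (fun (r : O * {ffun X -> M} * _) x => r.1.2 x),
  (fun (r : _ * {ffun M * Y -> Z}) m y => r.2 (m, y)) => x y P.
rewrite ProbE expect_bind; apply: eq_expect => o.
rewrite expect_bind.
rewrite -(expect_prod (a o) x (fun m => Prob (b o m y) (P o))).
apply: eq_expect => f; rewrite expect_bind.
under eq_expect do rewrite expect_dirac /=.
rewrite (expect_prod (fun my => b o my.1 my.2) (f x, y) (fun z => (P o z)%:R)).
by rewrite ProbE.
Qed.

End Expectation.

(** * Streams that insert a graph and then delete part of it *)

Section Streams.
Variable V : finType.
Implicit Types G H : {set {set V}}.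

Definition graph_stream G H : seq (update V) :=
  [seq Insert e | e <- enum G] ++ [seq Delete e | e <- enum H].

Lemma valid_inserts G (s : seq {set V}) (st : seq (update V)) :
  uniq s -> {in s, forall e : {set V}, #|e| = 2 /\ e \notin G} ->
  valid_from G ([seq Insert e | e <- s] ++ st) = valid_from (G :|: [set e in s]) st
  /\ foldl (@apply_update V) G [seq Insert e | e <- s] = G :|: [set e in s].
Proof.
elim: s G => [|e s IH] G /=.
  by move=> _ _; rewrite (_ : [set e in [::]] = set0) ?setU0 //; apply/setP.
case/andP=> es us sG.
have [/eqP e2 eG] := sG e (mem_head _ _).
have eqU : e |: G :|: [set x in s] = G :|: [set x in e :: s].
  by apply/setP=> x; rewrite !inE orbCA orbA.
have [|-> ->] := IH (e |: G) us; last by rewrite eqU e2 eG.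
move=> x xs; have [x2 xG] := sG x (mem_behead (s := e :: s) xs); split=> //.
rewrite !inE negb_or xG andbT; apply: contraNneq es => <-; exact: xs.
Qed.

Lemma valid_deletes G (s : seq {set V}) :
  uniq s -> {in s, forall e : {set V}, e \in G} ->
  valid_from G [seq Delete e | e <- s]
  /\ foldl (@apply_update V) G [seq Delete e | e <- s] = G :\: [set e in s].
Proof.
elim: s G => [|e s IH] G /=.
  by move=> _ _; rewrite (_ : [set e in [::]] = set0) ?setD0 //; apply/setP.
case/andP=> es us sG; rewrite sG ?mem_head //=.
have [|-> ->] := IH (G :\ e) us.
  move=> x xs; rewrite !inE (sG x (mem_behead (s := e :: s) xs)) andbT.
  by apply: contraNneq es => <-.
by split=> //; apply/setP=> x; rewrite !inE negb_or andbA [~~ _ && _]andbC.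
Qed.

Lemma graph_streamP G H :
  {in G, forall e : {set V}, #|e| = 2} -> H \subset G ->
  valid_stream (graph_stream G H) /\ final_graph (graph_stream G H) = G :\: H.
Proof.
move=> G2 HG; rewrite /valid_stream /final_graph /graph_stream foldl_cat.
have setE (X : {set {set V}}) : [set e in enum X] = X.
  by apply/setP=> e; rewrite inE mem_enum.
have [|-> ->] := @valid_inserts set0 (enum G) [seq Delete e | e <- enum H]
  (enum_uniq _).
  by move=> e; rewrite mem_enum inE => /G2.
rewrite setE set0U; have [|-> ->] := @valid_deletes G (enum H) (enum_uniq _).
  by move=> e; rewrite mem_enum => /(subsetP HG).
by rewrite setE.
Qed.

Lemma vc_number_le G (U : {set V}) :
  {in G, forall e : {set V}, #|e| = 2} -> vertex_cover G U -> (vc_number G <= #|U|)%N.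
Proof.
move=> G2 coverU; rewrite /vc_number; case: arg_minnP => [|U' _]; last exact.
apply/forall_inP => e /G2 e2; rewrite setIT -card_gt0 e2; lia.
Qed.

End Streams.

(** Markov property: the past matters only through the current state, so a run can be cut and
    resumed from a known state. *)
Lemma expect_foldl_bind (R : realType) (T : finType) (W : Type)
    (step : T -> W -> fdist R T) (mu : fdist R T) (st : seq W) (g : T -> R) :
  expect (foldl (fun nu w => fdist_bind nu (fun q => step q w)) mu st) g =
  expect mu (fun q0 => expect
    (foldl (fun nu w => fdist_bind nu (fun q => step q w)) (fdist_dirac R q0) st) g).
Proof.
elim: st mu => [|w st IH] mu /=.
  by apply: eq_expect => q; rewrite expect_dirac.
rewrite IH expect_bind; apply: eq_expect => q.
by rewrite [RHS]IH expect_bind expect_dirac.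
Qed.

(** * Error of one run on the masked and permuted graph *)

Section Reduction.
Variables (R : realType) (V : finType).
Implicit Types (pi : {perm V}) (X Y : {set V}) (M W : {set V * V}).

(* A permutation sends vertices to positions: M, W and the members of a box are
   pairs of vertices, while X, Y and the relation a live on positions. *)
Definition box pi X Y M : {set V * V} :=
  [set e in M | (pi e.1 \in X) && (pi e.2 \in Y)].

Definition mask pi (a : rel V) W : {set V * V} :=
  [set e | a (pi e.1) (pi e.2) (+) (e \in W)].

Definition edges M : {set {set V}} := [set [set e.1; e.2] | e in M].

(** Hence a uniform [W] yields a uniform masked set for every [pi], whatever [a] is: the masked set
    is independent of [pi]. *)
Lemma mask_inj pi a : injective (mask pi a).
Proof.
by move=> W W' /setP eqW; apply/setP=> e; have := eqW e; rewrite !inE => /addbI.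
Qed.

Lemma edges_boxP pi X M e :
  reflect (exists x y, [/\ (x, y) \in M, pi x \in X, pi y \notin X & e = [set x; y]])
          (e \in edges (box pi X (~: X) M)).
Proof.
apply: (iffP imsetP) => [[[x y]]|[x [y [xyM xX yX ->]]]].
  by rewrite !inE /= => /and3P[]; exists x, y.
by exists (x, y) => //; rewrite !inE xyM xX yX.
Qed.

Lemma card_edges_box pi X M :
  {in edges (box pi X (~: X) M), forall e : {set V}, #|e| = 2}.
Proof.
move=> e /edges_boxP[x [y [_ xX yX ->]]]; rewrite cards2.
by case: eqVneq => // xy; rewrite -xy xX in yX.
Qed.

Lemma bipartite_box pi X M (H : {set {set V}}) :
  bipartite (edges (box pi X (~: X) M) :\: H).
Proof.
exists (pi @^-1: X) => e /setDP[/edges_boxP[x [y [_ xX yX ->]]] _].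
split; apply/eqP/cards1P; [exists x | exists y]; apply/setP=> z; rewrite !inE.
  case: (eqVneq z x) => [->|_] /=; first by rewrite xX.
  by case: (eqVneq z y) => // ->; rewrite (negPf yX).
case: (eqVneq z y) => [->|_] /=; first by rewrite yX orbT.
by rewrite orbF; case: (eqVneq z x) => [->|_]; rewrite ?xX ?andbF.
Qed.

Section Square.
Variables (s : nat) (B : stream_alg R V s) (c p : R) (L P Q : {set V}) (u v : V).
Hypotheses (B_ok : mvc_approx_bipartite B c p) (c0 : 0 <= c).
Hypotheses (uP : u \in P) (vQ : v \in Q) (PL : P \subset L) (QL : Q \subset ~: L).

Definition target pi : V * V := ((pi^-1)%g u, (pi^-1)%g v).

Definition run pi M (D : {set V * V}) : fdist R {set V} :=
  alg_result B (graph_stream (edges (box pi L (~: L) M)) (edges D)).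

Definition remaining pi M (D : {set V * V}) : {set {set V}} :=
  edges (box pi L (~: L) M) :\: edges D.

Let bound : R := c * (#|L :\: P| + #|~: L :\: Q|)%:R.

Lemma square_sub pi M : box pi P Q M \subset box pi L (~: L) M.
Proof.
apply/subsetP=> e; rewrite !inE => /and3P[-> eP eQ].
by rewrite (subsetP PL) //=; have := subsetP QL _ eQ; rewrite inE.
Qed.

(** An edge avoiding these vertices has its row in [P] and its column in [Q], so it was deleted. The
    size of this cover is the number that [bound] multiplies by [c]. *)
Lemma square_complement_cover pi M :
  vertex_cover (remaining pi M (box pi P Q M))
               (pi @^-1: ((L :\: P) :|: (~: L :\: Q))).
Proof.
apply/forall_inP => e /setDP[/edges_boxP[x [y [xyM xL yL ->]]]] notsq.
have [xP|xP] := boolP (pi x \in P); last first.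
  by apply/set0Pn; exists x; rewrite !inE eqxx xP xL.
apply/set0Pn; exists y; rewrite !inE eqxx orbT yL /=.
rewrite andbT; apply/orP; right; apply: contra notsq => yQ.
by apply/imsetP; exists (x, y); rewrite // inE xyM xP yQ.
Qed.

Lemma run_fail pi M (D : {set V * V}) : D \subset box pi P Q M ->
  Prob (run pi M D) (predC (fun U => vertex_cover (remaining pi M D) U &&
    (#|U|%:R <= c * (vc_number (remaining pi M D))%:R))) <= p.
Proof.
move=> Dsq; rewrite Prob_predC lerBlDr -lerBlDl.
have [|valid_st final_st] := @graph_streamP _ (edges (box pi L (~: L) M)) (edges D)
    (@card_edges_box pi L M).
  exact: imsetS (subset_trans Dsq (square_sub pi M)).
have := B_ok valid_st; rewrite final_st; apply; exact: bipartite_box.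
Qed.

(** The whole square is deleted here, target included, so that the stream does not depend on [w] and
    different [w] can be compared. This agrees with Bob's deletions when the target is not in [M],
    the only case where a hit matters. *)
Definition hit pi M w : R :=
  Prob (run pi M (box pi P Q M))
    (fun U => (#|U|%:R <= bound) && ((pi^-1)%g w \in U)).

Lemma run_error pi M :
  Prob (run pi M (box pi P Q M :\ target pi))
    (fun U => ((pi^-1)%g u \in U) || ((pi^-1)%g v \in U) != (target pi \in M))
  <= p + (hit pi M u + hit pi M v).
Proof.
have hit_ge0 w : 0 <= hit pi M w by apply: sumr_ge0 => U _; exact: pmf_ge0.
have piu : pi ((pi^-1)%g u) = u by rewrite permKV.
have piv : pi ((pi^-1)%g v) = v by rewrite permKV.
have uL := subsetP PL _ uP.
have vL : v \notin L by have := subsetP QL _ vQ; rewrite inE.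
have [tM|tM] := boolP (target pi \in M).
  (* The target edge survives, so an output missing both its endpoints is not a cover: a wrong
     answer implies a failure of the algorithm. *)
  rewrite -[leLHS]addr0 lerD ?addr_ge0 //.
  apply: le_trans (run_fail (subsetDl _ _)).
  apply: le_Prob => U /=; rewrite eqb_id => miss; apply: contra miss => /andP[cov _].
  have /(forall_inP cov)/set0Pn[z] :
      [set (target pi).1; (target pi).2] \in
      remaining pi M (box pi P Q M :\ target pi).
    apply/setDP; split.
      by apply: imset_f; rewrite !inE tM /= piu piv uL vL.
    (* Edges are unordered, so a deleted pair could give the target edge with endpoints swapped; the
       sides [L] and [~: L] exclude this. *)
    apply/imsetP => -[[x y] /setD1P[xyt]]; rewrite inE /= => /and3P[_ xP yQ] eqt.
    have xL := subsetP PL _ xP.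
    have yL : pi y \notin L by have := subsetP QL _ yQ; rewrite inE.
    have : (target pi).1 \in [set x; y] by rewrite -eqt !inE eqxx.
    have : (target pi).2 \in [set x; y] by rewrite -eqt !inE eqxx orbT.
    rewrite !inE /= => /orP[/eqP ex|/eqP ey].
      by rewrite -ex piv (negPf vL) in xL.
    case/orP=> /eqP ex; last by rewrite -ex piu uL in yL.
    by rewrite -ex -ey eqxx in xyt.
  by rewrite !inE /= => /andP[/orP[] /eqP <- ->]; rewrite ?orbT.
(* The target is absent, so the whole square is deleted; a wrong answer is then a failure of the
   algorithm or a hit by a small cover. *)
have -> : box pi P Q M :\ target pi = box pi P Q M.
  apply/setP=> e; rewrite in_setD1; case: eqVneq => // ->.
  by rewrite inE (negPf tM).
apply: le_trans (lerD (run_fail (subxx _)) (lexx _)).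
apply: le_trans (lerD (lexx _) (Prob_predU _ _ _)).
apply: le_trans (Prob_predU _ _ _).
apply: le_Prob => U /=; set G := remaining _ _ _; rewrite eqbF_neg negbK => hitU.
case: (boolP (vertex_cover G U)) => //= _; case: leP => //= Usmall.
rewrite -andb_orr hitU andbT (le_trans Usmall) // ler_wpM2l // ler_nat.
apply: leq_trans (vc_number_le _ (square_complement_cover pi M)) _.
  move=> e /setDP[eG _]; exact: card_edges_box e eG.
rewrite card_preimset; last exact: perm_inj.
by rewrite cardsU leq_subr.
Qed.

(* The stream depends on pi only through the preimages of L, P and Q. *)
Lemma hit_tperm pi M w w' :
  (w \in L) = (w' \in L) -> (w \in P) = (w' \in P) -> (w \in Q) = (w' \in Q) ->
  hit (pi * tperm w w')%g M w = hit pi M w'.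
Proof.
move=> wL wP wQ.
have boxE X Y : (w \in X) = (w' \in X) -> (w \in Y) = (w' \in Y) ->
    box (pi * tperm w w')%g X Y M = box pi X Y M.
  have tpE Z z : (w \in Z) = (w' \in Z) -> (tperm w w' z \in Z) = (z \in Z).
    by move=> wZ; case: tpermP => // ->.
  by move=> wX wY; apply/setP=> e; rewrite !inE !permM !tpE.
by rewrite /hit /run !boxE ?inE ?wL // invMg tpermV permM tpermL.
Qed.

(** Double counting: an output of size at most [bound] contains the preimages of at most [bound]
    positions. *)
Lemma sum_hit_le pi M (S : {set V}) : \sum_(w in S) hit pi M w <= bound.
Proof.
have bound_ge0 : 0 <= bound by rewrite mulr_ge0.
under eq_bigr do rewrite /hit ProbE.
rewrite -expect_sum -[leRHS](expect_cst (run pi M (box pi P Q M))).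
apply: le_expect => U; case: (leP #|U|%:R bound) => [Usmall|_] /=; last by rewrite big1.
rewrite -natr_sum; apply: le_trans Usmall; rewrite ler_nat.
rewrite -(card_preimset U (@perm_inj _ pi^-1%g)) -sum1_card big_mkcond /=.
rewrite [leqRHS]big_mkcond; apply: leq_sum => w _; rewrite inE.
by case: (w \in S); case: (_ \in U).
Qed.

Definition perm_mean (f : {perm V} -> R) : R :=
  expect (fdist_uniform R (1%g : {perm V})) f.

Definition mask_mean (f : {set V * V} -> R) : R :=
  expect (fdist_uniform R (set0 : {set V * V})) f.

(** By symmetry all positions in [S] have the same mean hit probability, and these sum to at most
    [bound]. *)
Lemma mean_hit (S : {set V}) w : w \in S ->
  (forall w', w' \in S -> [/\ (w \in L) = (w' \in L), (w \in P) = (w' \in P)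
     & (w \in Q) = (w' \in Q)]) ->
  perm_mean (fun pi => mask_mean (fun M => hit pi M w)) <= bound / #|S|%:R.
Proof.
move=> wS sameS; have S0 : (0 < #|S|)%N by apply/card_gt0P; exists w.
rewrite ler_pdivlMr ?ltr0n // mulr_natr -sumr_const.
rewrite (eq_bigr (fun w' => perm_mean (fun pi => mask_mean (fun M => hit pi M w')))).
  rewrite -expect_sum -[leRHS](expect_cst (fdist_uniform R (1%g : {perm V}))).
  apply: le_expect => pi; rewrite -expect_sum.
  rewrite -[leRHS](expect_cst (fdist_uniform R (set0 : {set V * V}))).
  by apply: le_expect => M; exact: sum_hit_le.
move=> w' /sameS[wL wP wQ].
(* Right multiplication by the transposition preserves the uniform permutation, and the law of [M]
   does not involve it. *)
rewrite -[LHS](expect_reindex _ _ (@mulIg _ (tperm w w'))).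
apply: eq_expect => pi /=; apply: eq_expect => M; exact: hit_tperm.
Qed.

Lemma mean_error (a : rel V) :
  perm_mean (fun pi => mask_mean (fun W =>
    let M := mask pi a W in
    Prob (run pi M (box pi P Q M :\ target pi))
      (fun U => ((pi^-1)%g u \in U) || ((pi^-1)%g v \in U) != (target pi \in M))))
  <= p + (bound / #|P|%:R + bound / #|Q|%:R).
Proof.
have uL := subsetP PL _ uP.
have vL : v \notin L by have := subsetP QL _ vQ; rewrite inE.
have meanu := @mean_hit P u uP _; have meanv := @mean_hit Q v vQ _.
have notQ w : w \in L -> (w \in Q) = false.
  by move=> wL; apply: contraTF wL => /(subsetP QL); rewrite inE.
have notL w : w \in Q -> (w \in L) = false.
  by move=> wQ; apply: contraTF wQ => /notQ ->.
have notP w : w \in Q -> (w \in P) = false.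
  by move=> wQ; apply: contraTF wQ => /(subsetP PL) /notQ ->.
apply: (@le_trans _ _ (p + (perm_mean (fun pi => mask_mean (fun M => hit pi M u)) +
   perm_mean (fun pi => mask_mean (fun M => hit pi M v))))); last first.
  rewrite lerD2l lerD //; [apply: meanu | apply: meanv] => w wS.
    by have wL := subsetP PL _ wS; rewrite uL uP wL wS !notQ.
  by rewrite vQ wS !notL ?notP.
rewrite -expectD -[X in X + _](expect_cst (fdist_uniform R (1%g : {perm V}))).
rewrite -expectD; apply: le_expect => pi.
rewrite -expectD -[X in X + _](expect_cst (fdist_uniform R (set0 : {set V * V}))).
rewrite -expectD -[leRHS](expect_reindex _ _ (@mask_inj pi a)).
by apply: le_expect => W; exact: run_error.
Qed.

End Square.
End Reduction.

(** * Cutting a run of the algorithm between the two parties *)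

Definition resume (R : realType) (V : finType) (s : nat) (B : stream_alg R V s)
    (r : alg_rand B) (q : s.-tuple bool) (st : seq (update V)) : fdist R {set V} :=
  fdist_bind (foldl (fun mu w => fdist_bind mu (fun q => alg_step r q w))
                    (fdist_dirac R q) st) (alg_out r).

Lemma Prob_alg_result_cat (R : realType) (V : finType) (s : nat)
    (B : stream_alg R V s) (st st' : seq (update V)) (S : pred {set V}) :
  Prob (alg_result B (st ++ st')) S =
  expect (alg_dist B) (fun r => expect (alg_memory r st)
    (fun q => Prob (resume r q st') S)).
Proof.
rewrite ProbE expect_bind; apply: eq_expect => r.
rewrite expect_bind /alg_memory foldl_cat expect_foldl_bind.
by apply: eq_expect => q; rewrite ProbE expect_bind.
Qed.

Lemma card_ord_interval (n a b : nat) :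
  (b <= n)%N -> #|[set q : 'I_n | (a <= q < b)%N]| = (b - a)%N.
Proof.
move=> bn; rewrite -sum1_card.
under eq_bigl do rewrite inE andbC.
rewrite -(big_mkord (fun q => (q < b) && (a <= q))%N (fun=> 1%N)) -big_nat_widenl //.
by rewrite -(big_nat_widen _ _ _ xpredT) // sum_nat_const_nat muln1.
Qed.

(** * The one-way protocol for given parameters *)

Section Protocol.
Variables (R : realType) (n k s N : nat) (B : stream_alg R 'I_n s) (c p delta : R).
Hypotheses (B_ok : mvc_approx_bipartite B c p) (c0 : 0 <= c).
Hypotheses (N2n : (N + N <= n)%N) (Nk : (n - N <= k)%N).
Hypothesis error_le : forall x y : 'I_(n - k),
  p + (c * (x + y)%:R / (N - x)%:R + c * (x + y)%:R / (n - N - y)%:R) <= delta.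

(* The vertices below N stand for rows, and N + j stands for column j. *)
Let L : {set 'I_n} := [set q : 'I_n | (q < N)%N].
Let P (x : 'I_(n - k)) : {set 'I_n} := [set q : 'I_n | (x <= q < N)%N].
Let Q (y : 'I_(n - k)) : {set 'I_n} := [set q : 'I_n | (N + y <= q < n)%N].

Lemma column_proof (y : 'I_(n - k)) : (N + y < n)%N.
Proof. have := ltn_ord y; lia. Qed.

Definition column (y : 'I_(n - k)) : 'I_n := Ordinal (column_proof y).

(** Inverse to the embedding of columns. Below [N] truncated subtraction gives the junk value 0, but
    the boxes in use keep only pairs whose second position is at least [N]. *)
Definition column_index (q : 'I_n) : 'I_n :=
  Ordinal (leq_ltn_trans (leq_subr N q) (ltn_ord q)).

Definition matrix_rel (A : 'M[bool]_n) : rel 'I_n := fun i q => A i (column_index q).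

(** An unknown entry reads as [false]; inside the square this happens only at the target, which is
    never deleted. *)
Definition view_rel (w : 'M[option bool]_n) : rel 'I_n :=
  fun i q => w i (column_index q) == Some true.

Definition bob_deletes pi (W : {set 'I_n * 'I_n}) (a : rel 'I_n) (x y : 'I_(n - k)) :=
  box pi (P x) (Q y) (mask pi a W) :\ target (bind_index x) (column y) pi.

(** The square fits in the window known to Bob: its rows stay below [N] and its columns below
    [n - N], both at most [k]. *)
Lemma bob_deletes_view pi W (A : 'M[bool]_n) (x y : 'I_(n - k)) :
  bob_deletes pi W (view_rel (bind_view A x y)) x y =
  bob_deletes pi W (matrix_rel A) x y.
Proof.
apply/setP=> -[e f]; rewrite in_setD1 [RHS]in_setD1 !inE /=.
case: eqVneq => //= eft; apply: andb_id2r => /andP[/andP[xe eN] /andP[yf _]].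
rewrite /view_rel /matrix_rel mxE ifT; first by case: (A _ _).
apply/and3P; split; [lia | rewrite /=; have := ltn_ord (pi f); lia |].
apply: contraNneq eft => -[ex fy].
rewrite /target -ex; apply/eqP; congr pair; first by rewrite permK.
apply: (canRL (permK pi)); apply: val_inj => /=; lia.
Qed.

Lemma BInd_protocol :
  exists Pi : oneway_protocol R 'M[bool]_n (bob_input n k) bool s, solves_BInd Pi delta.
Proof.
(* The random string of the algorithm is public too, since both halves of the run must use the same
   one. *)
pose coins := fdist_bind (fdist_uniform R (1%g : {perm 'I_n})) (fun pi =>
  fdist_bind (fdist_uniform R (set0 : {set 'I_n * 'I_n})) (fun W =>
  fdist_bind (alg_dist B) (fun r => fdist_dirac R (pi, W, r)))).
pose inserts pi W (A : 'M[bool]_n) :=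
  [seq Insert e | e <- enum (edges (box pi L (~: L) (mask pi (matrix_rel A) W)))].
pose deletes pi W (i : bob_input n k) :=
  [seq Delete e | e <- enum (edges (bob_deletes pi W (view_rel i.2) i.1.1 i.1.2))].
pose answer pi (W : {set 'I_n * 'I_n}) (i : bob_input n k) (U : {set 'I_n}) :=
  let t := target (bind_index i.1.1) (column i.1.2) pi in
  ((t.1 \in U) || (t.2 \in U)) (+) (t \in W).
have [O [d [w [a [b publicE]]]]] := public_coins coins
  (fun o A => alg_memory o.2 (inserts o.1.1 o.1.2 A))
  (fun o q i => resume o.2 q (deletes o.1.1 o.1.2 i)).
exists (@OneWay _ _ _ _ s O d a
  (fun r q i => answer (w r).1.1 (w r).1.2 i (b r q i))) => A x y /=.
set i := (x, y, bind_view A x y).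
set bit := A _ _.
rewrite (publicE A i (fun o U => answer o.1.1 o.1.2 i U == bit)).
rewrite expect_bind.
have xP : bind_index x \in P x by rewrite inE /= leqnn; have := ltn_ord x; lia.
have yQ : column y \in Q y by rewrite inE /= leqnn; have := ltn_ord y; lia.
have PL : P x \subset L by apply/subsetP => q; rewrite !inE => /andP[].
have QL : Q y \subset ~: L by apply/subsetP => q; rewrite !inE; lia.
have := @mean_error R _ s B c p L (P x) (Q y) _ _ B_ok c0 xP yQ PL QL (matrix_rel A).
have -> : #|P x| = (N - x)%N by apply: card_ord_interval; lia.
have -> : #|Q y| = (n - N - y)%N by rewrite card_ord_interval // subnDA.
have -> : #|L :\: P x| = x.
  rewrite -[RHS]subn0 -(@card_ord_interval n 0 x); last by have := ltn_ord x; lia.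
  by apply: eq_card => q; rewrite !inE; have := ltn_ord x; lia.
have -> : #|~: L :\: Q y| = y.
  rewrite -[RHS](addKn N) -(@card_ord_interval n N (N + y)).
    by apply: eq_card => q; rewrite !inE; have := ltn_ord q; lia.
  exact: ltnW (column_proof y).
move=> /le_trans/(_ (error_le x y)) err_le.
rewrite lerBlDr -lerBlDl; apply: le_trans err_le.
(* It suffices that, for fixed [pi] and [W], the success and error probabilities add up to at least
   1. *)
rewrite lerBlDr -expectD -[leLHS](expect_cst (fdist_uniform R (1%g : {perm 'I_n}))).
apply: le_expect => pi; rewrite expect_bind -expectD.
rewrite -[leLHS](expect_cst (fdist_uniform R (set0 : {set 'I_n * 'I_n}))).
apply: le_expect => W; rewrite expect_bind.
under eq_expect do rewrite expect_dirac /=.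
rewrite -Prob_alg_result_cat /deletes /= bob_deletes_view.
rewrite -lerBlDl -Prob_predC; apply: le_Prob => U /=.
(* [W] masks the target entry once in the graph and once in the answer, so it cancels. *)
rewrite /answer /= inE /= !permKV /matrix_rel.
have -> : column_index (column y) = bind_index y by apply: val_inj => /=; rewrite addKn.
by rewrite -/bit; case: (_ || _); case: bit; case: (_ \in W).
Qed.

End Protocol.

(** * Choice of parameters for large [n] *)

Theorem theorem9 (R : realType) :
  exists C : nat,
  forall (eps : R) (s : nat -> nat) (B : forall n : nat, stream_alg R 'I_n (s n)),
    0 < eps < 1 ->
    (forall n : nat, mvc_approx_bipartite (B n) (n%:R `^ eps) (1 / 400)) ->
    exists n0 : nat, forall n k : nat, (n0 <= n)%N ->
      `|k%:R - (n%:R - 1 / 40 * n%:R `^ (1 - eps))| < 1 ->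
      exists (t : nat) (Pi : oneway_protocol R 'M[bool]_n (bob_input n k) bool t),
        (t <= C * s n)%N /\ solves_BInd Pi (1 / 3).
Proof.
(* The message is a single memory state, hence the factor 1. From 10 on, rounding n/2 down and
   removing n/40 still leaves 2n/5. *)
exists 1%N => eps s B /andP[eps0 eps1] B_ok; exists 10%N => n k n10.
have nR : 10 <= n%:R :> R by rewrite ler_nat.
have ce : n%:R `^ eps * n%:R `^ (1 - eps) = n%:R :> R.
  rewrite -powRD; first by rewrite addrC subrK powRr1 // ler0n.
  by apply/implyP => _; apply/eqP => n0; rewrite n0 in nR; lra.
have c1 : 1 <= n%:R `^ eps :> R.
  by rewrite -[leLHS](powRr0 n%:R) ler_powR; lra.
have e0 : 0 <= n%:R `^ (1 - eps) :> R by exact: powR_ge0.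
move: (B_ok n) ce c1 e0.
set c := _ `^ eps; set e := _ `^ (1 - eps) => Bn ce c1 e0.
rewrite ltr_norml => /andP[k_gt k_lt].
have en : e <= n%:R by rewrite -ce ler_peMl.
have half : n%:R <= 2 * (n./2)%:R + 1 :> R.
  by rewrite -[n in leLHS]odd_double_half -muln2 natrD natrM; case: (odd n) => /=; lra.
have Nk : (n - n./2 <= k)%N.
  have nk : n%:R - (n./2)%:R <= k%:R :> R by lra.
  by rewrite leq_subLR -(ler_nat R) natrD; lra.
have N2n : (n./2 + n./2 <= n)%N by rewrite addnn -geq_half_double.
have kN : (n - k <= n./2)%N by rewrite leq_subCl.
(* Rounding can make [k] too small by almost 1; as indices start at 0, [x + 1 <= n - k] recovers
   this unit. *)
have index_le (x : 'I_(n - k)) : x%:R <= 1 / 40 * e.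
  have : (k + x < n)%N by rewrite -ltn_subRL.
  by rewrite -(ler_nat R) -natr1 natrD; lra.
have c0 : 0 <= c by lra.
(* The total is at most 1/400 + 1/8 + 1/8, which is below 1/3. *)
have error_le (x y : 'I_(n - k)) :
    1 / 400 + (c * (x + y)%:R / (n./2 - x)%:R +
               c * (x + y)%:R / (n - n./2 - y)%:R) <= 1 / 3 :> R.
  have xe := index_le x; have ye := index_le y.
  have num : c * (x + y)%:R <= 1 / 20 * n%:R.
    by rewrite -ce mulrCA ler_wpM2l ?natrD; lra.
  have ratio (m : nat) (z : 'I_(n - k)) :
      (n./2 <= m)%N -> c * (x + y)%:R / (m - z)%:R <= 1 / 8.
    move=> m_ge; have ze := index_le z.
    have : 2 / 5 * n%:R <= (m - z)%:R :> R.
      rewrite natrB; first by move: m_ge; rewrite -(ler_nat R); lra.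
      exact: ltnW (leq_trans (ltn_ord z) (leq_trans kN m_ge)).
    by move=> mz; rewrite ler_pdivrMr; lra.
  have := ratio n./2 x (leqnn _).
  have : (n./2 <= n - n./2)%N by rewrite -[leqLHS](addnK n./2) leq_sub2r.
  by move=> /(ratio _ y); lra.
have [Pi Pi_ok] := BInd_protocol Bn c0 N2n Nk error_le.
by exists (s n), Pi; rewrite mul1n.
Qed.
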